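(* Suppose $\pi$ is a Fishburn permutation with $g(\pi)=\alpha$. Then $\pi$ avoids $3412$ if and only if $\alpha$ avoids $201$. In particular, $|F_n(3412)|=|A_n(201)|$ for all $n\ge 0$.
   Context: A sequence of integers (in particular a permutation in one-line notation) contains a sequence $\beta$ if it has a subsequence with the same length and relative order as $\beta$; otherwise it avoids $\beta$. A Fishburn permutation is a permutation $\pi$ with no subsequence $\pi_j,\pi_{j+1},\pi_k$ such that $j+1<k$, $\pi_j=\pi_k+1$, and $\pi_{j+1}>\pi_j$. An ascent sequence is a sequence $a_1\cdots a_n$ of nonnegative integers with $a_1=0$ and $a_j\le 1+\operatorname{asc}(a_1\cdots a_{j-1})$ for each $j\ge 2$, where $\operatorname{asc}$ counts the indices $i$ with $a_i<a_{i+1}$. $F_n(\sigma)$ is the set of Fishburn permutations of length $n$ avoiding $\sigma$; $A_n(\beta)$ is the set of ascent sequences of length $n$ avoiding $\beta$. The map $g$: a site of a Fishburn permutation of length $m-1$ is a space between two adjacent entries, before the first entry, or after the last entry ($m$ sites in all). A site is active if inserting $m$ into it gives a Fishburn permutation. Active sites are numbered from left to right, starting with $0$. Each Fishburn permutation $\pi$ of length $n$ is constructed uniquely, starting from the empty permutation, by successively inserting $1,2,\ldots,n$ into active sites; $g(\pi)=a_1\cdots a_n$, where $a_m$ is the number of the active site into which $m$ is inserted. It is known (Bousquet-Mélou, Claesson, Dukes, Kitaev) that $g$ is a bijection from Fishburn permutations of length $n$ to ascent sequences of length $n$. *)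

(* Defs.v *)
From HB Require Import structures.
From mathcomp Require Import all_boot.

Set Implicit Arguments.
Unset Strict Implicit.
Unset Printing Implicit Defensive.

(* Sequences of integers, and permutations in one-line notation, are terms of
   [seq nat]. Positions start at 0, so the paper's pi_j is [nth 0 pi j.-1];
   a permutation of length n has the values 1, ..., n. *)

Definition same_order (s t : seq nat) : bool :=
  (size s == size t) &&
  [forall i : 'I_(size s), forall j : 'I_(size s),
     (nth 0 s i < nth 0 s j) == (nth 0 t i < nth 0 t j)].

Definition contains (s beta : seq nat) : bool :=
  [exists m : (size s).-tuple bool, same_order (mask m s) beta].

Definition avoids (s beta : seq nat) : bool := ~~ contains s beta.

Lemma containsP s beta :
  reflect (exists2 t, subseq t s & same_order t beta) (contains s beta).
Proof.
apply: (iffP existsP) => [[m mP]|[t /subseqP[m sz_m ->] tP]].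
  by exists (mask m s) => //; apply: mask_subseq.
have sz : size m == size s by rewrite sz_m.
by exists (Tuple sz).
Qed.

Definition is_perm (s : seq nat) : bool := perm_eq s (iota 1 (size s)).

Definition fishburn (s : seq nat) : bool :=
  is_perm s &&
  [forall j : 'I_(size s), forall k : 'I_(size s),
     ~~ [&& j.+1 < k, nth 0 s j == (nth 0 s k).+1 & nth 0 s j < nth 0 s j.+1]].

Definition asc (a : seq nat) : nat :=
  count (fun i => nth 0 a i < nth 0 a i.+1) (iota 0 (size a).-1).

(* The empty sequence is an ascent sequence. *)
Definition ascent_seq (a : seq nat) : bool :=
  (nth 0 a 0 == 0) &&
  [forall j : 'I_(size a), (0 < j) ==> (nth 0 a j <= 1 + asc (take j a))].

(* Site i of s is the space having exactly i entries of s on its left. *)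
Definition insert_at (i m : nat) (s : seq nat) : seq nat :=
  take i s ++ m :: drop i s.

Definition active_site (s : seq nat) (i : nat) : bool :=
  fishburn (insert_at i (size s).+1 s).

(* In increasing order, so that active site number a is the a-th item. *)
Definition active_sites (s : seq nat) : seq nat :=
  [seq i <- iota 0 (size s).+1 | active_site s i].

(* The stage of the construction of s at which 1, ..., m have been inserted. *)
Definition stage (s : seq nat) (m : nat) : seq nat := [seq x <- s | x <= m].

(* The letter m goes into the site of [stage s m.-1] given by the position of
   m in [stage s m]; its label is the rank of that site among the active ones.
   See [g_nil] and [g_insert_active] for the recursive description. *)
Definition g (s : seq nat) : seq nat :=
  [seq index (index m (stage s m)) (active_sites (stage s m.-1))
     | m <- iota 1 (size s)].

Lemma g_nil : g [::] = [::]. Proof. by []. Qed.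

Lemma size_insert_at i m s : size (insert_at i m s) = (size s).+1.
Proof. by rewrite size_cat /= addnS -size_cat cat_take_drop. Qed.

Lemma is_perm_mem s x : is_perm s -> (x \in s) = (0 < x <= size s).
Proof. by move=> /perm_mem ->; rewrite mem_iota add1n ltnS. Qed.

Lemma stage_size s : is_perm s -> stage s (size s) = s.
Proof.
move=> sP; apply/all_filterP/allP => x.
by rewrite is_perm_mem // => /andP[].
Qed.

Lemma g_insert_active s a : is_perm s -> a < size (active_sites s) ->
  g (insert_at (nth 0 (active_sites s) a) (size s).+1 s) = rcons (g s) a.
Proof.
move=> sP a_lt; set i := nth _ _ _; set n := size s.
have /[!mem_filter] /andP[_ /[!mem_iota] /= i_le] : i \in active_sites s.
  exact: mem_nth.
have stE m : m <= n -> stage (insert_at i n.+1 s) m = stage s m.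
  move=> mn; rewrite /stage filter_cat /= ltnNge mn /= -filter_cat.
  by rewrite cat_take_drop.
have nNs : n.+1 \notin s by rewrite is_perm_mem // ltnn andbF.
rewrite /g size_insert_at -/n -[X in iota 1 X]addn1 iotaD map_cat /= add1n -cats1.
congr (_ ++ [:: _]).
  by apply/eq_in_map => m; rewrite mem_iota => /andP[_ mn]; rewrite !stE // (leq_trans (leq_pred m)).
rewrite (stE n) // stage_size //.
have -> : stage (insert_at i n.+1 s) n.+1 = insert_at i n.+1 s.
  apply/all_filterP/allP => x; rewrite mem_cat inE => xs.
  have [->//|xn] := eqVneq x n.+1.
  have : x \in s by rewrite -(cat_take_drop i s) mem_cat; move: xs; rewrite (negPf xn).
  by rewrite is_perm_mem // => /andP[_ /leqW].
have -> : index n.+1 (insert_at i n.+1 s) = i.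
  rewrite index_cat /= eqxx addn0 ifN ?size_takel //.
  by apply: contra nNs; apply: mem_take.
by rewrite index_uniq // filter_uniq // iota_uniq.
Qed.

(* Entries are bounded by the length both in a permutation and in an ascent
   sequence, so tuples over 'I_n.+1 cover all cases: see [F_spec], [A_spec]. *)
Definition F (n : nat) (sigma : seq nat) : {set n.-tuple 'I_n.+1} :=
  [set t : n.-tuple 'I_n.+1 |
    fishburn [seq val x | x <- t] && avoids [seq val x | x <- t] sigma].

Definition A (n : nat) (beta : seq nat) : {set n.-tuple 'I_n.+1} :=
  [set t : n.-tuple 'I_n.+1 |
    ascent_seq [seq val x | x <- t] && avoids [seq val x | x <- t] beta].

Lemma bounded_tuple n (s : seq nat) : size s = n -> all (fun x => x <= n) s ->
  exists t : n.-tuple 'I_n.+1, [seq val x | x <- t] = s.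
Proof.
move=> sz /allP sn; have sz' : size [seq inord x : 'I_n.+1 | x <- s] == n.
  by rewrite size_map sz.
exists (Tuple sz') => /=; rewrite -map_comp -[RHS]map_id.
by apply/eq_in_map => x /sn xn /=; rewrite inordK.
Qed.

Lemma ascent_seq_bound a i : ascent_seq a -> i < size a -> nth 0 a i <= i.
Proof.
move=> /andP[/eqP a0 /forallP aP] ia; have [->|i0] := posnP i; first by rewrite a0.
have /implyP/(_ i0)/leq_trans := aP (Ordinal ia); apply.
rewrite /asc (size_takel (ltnW ia)) add1n.
by apply: leq_ltn_trans (count_size _ _) _; rewrite size_iota ltn_predL.
Qed.

Lemma F_spec n sigma s :
  (exists2 t, t \in F n sigma & [seq val x | x <- t] = s) <->
  [/\ size s = n, fishburn s & avoids s sigma].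
Proof.
split=> [[t /[!inE] /andP[tF tA] <-]|[sz sF sA]]; first by rewrite size_map size_tuple.
have [|t ts] := bounded_tuple sz; last by exists t => //; rewrite inE ts sF.
by apply/allP => x; rewrite is_perm_mem ?sz; [case/andP|case/andP: sF].
Qed.

Lemma A_spec n beta a :
  (exists2 t, t \in A n beta & [seq val x | x <- t] = a) <->
  [/\ size a = n, ascent_seq a & avoids a beta].
Proof.
split=> [[t /[!inE] /andP[tF tA] <-]|[sz sF sA]]; first by rewrite size_map size_tuple.
have [|t ts] := bounded_tuple sz; last by exists t => //; rewrite inE ts sF.
apply/(all_nthP 0) => i ia; apply: leq_trans (ascent_seq_bound sF ia) _.
by rewrite -sz ltnW.
Qed.

(* Main.v *)
(* Call a value v of a Fishburn permutation good if v = 1 or v - 1 lies to the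
   left of v. The active sites are the leftmost one and those just after a good
   value, so the label of m is the number of good values smaller than m on its
   left; m + 1 is good iff its label exceeds the label of m, hence the active
   sites number asc + 2 and g is onto the ascent sequences. Moreover, between
   a smaller value x and a later m there is always a good value u < m
   (possibly u = x).
   If i < j < k have labels forming a 201, comparing labels gives a good v < i
   with k, v, i in this order from left to right, and some w with j <= w < k
   to the left of k, so that w k v i is a 3412. Conversely, in a 3412
   occurrence c d a b with d minimal, the labels of b < c < d form a 201. *)
Require Import Defs.
From mathcomp Require Import all_boot.
From mathcomp Require Import zify.

Set Implicit Arguments.
Unset Strict Implicit.
Unset Printing Implicit Defensive.

(** * Counting, and subsequences as increasing lists of positions *)

Lemma index_filter_iota (p : pred nat) n i : i < n -> p i ->
  index i (filter p (iota 0 n)) = count p (iota 0 i).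
Proof.
move=> lt_in pi; have -> : n = i + (n - i).-1.+1 by lia.
rewrite iotaD filter_cat /= add0n pi index_cat /= eqxx addn0 size_filter.
by rewrite mem_filter mem_iota add0n ltnn !andbF.
Qed.

Lemma sub_in_count (T : eqType) (p q : pred T) (s : seq T) :
  {in s, subpred p q} -> count p s <= count q s.
Proof.
move=> pq; rewrite (eq_in_count (a2 := predI p q)) => [|x xs /=].
  by apply: sub_count => x /andP[].
by case px: (p x) => //; rewrite (pq _ xs px).
Qed.

Lemma ltn_in_count (T : eqType) (p q : pred T) (s : seq T) u :
  {in s, subpred p q} -> u \in s -> q u -> ~~ p u -> count p s < count q s.
Proof.
move=> pq us qu pu; rewrite (permP (perm_to_rem us) p) (permP (perm_to_rem us) q).
rewrite /= qu (negPf pu) add0n add1n ltnS; apply: sub_in_count => x /mem_rem.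
exact: pq.
Qed.

Lemma ltn_count_ex (T : eqType) (p q : pred T) (s : seq T) :
  count p s < count q s ->
  exists2 u, u \in s & q u && ~~ p u.
Proof.
move=> lt_pq; apply/hasP; apply: contraLR lt_pq => /hasPn no.
rewrite -leqNgt; apply: sub_in_count => x /no.
by rewrite negb_and negbK; case: (q x).
Qed.

Lemma subseq_nthP (T : eqType) (x0 : T) (t s : seq T) :
  reflect (exists idx, [/\ sorted ltn idx, all (fun i => i < size s) idx
                         & t = [seq nth x0 s i | i <- idx]])
          (subseq t s).
Proof.
apply: (iffP idP) => [/subseqP[m sz_m ->]|[idx [idx_s idx_lt ->]]].
  have sub_m : subseq (mask m (iota 0 (size s))) (iota 0 (size s)).
    exact: mask_subseq.
  exists (mask m (iota 0 (size s))); split.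
  - exact: subseq_sorted ltn_trans _ _ sub_m (iota_ltn_sorted _ _).
  - by apply/allP => i /(mem_subseq sub_m); rewrite mem_iota.
  - by rewrite map_mask map_nth_iota0 // take_size.
rewrite -[X in subseq _ X](@mkseq_nth _ x0) /mkseq; apply: map_subseq.
(* A strictly increasing list of positions is determined by its set of members. *)
have -> : idx = [seq i <- iota 0 (size s) | i \in idx]; last exact: filter_subseq.
apply: irr_sorted_eq ltn_trans ltnn _ _ idx_s _ _ => [|i].
  exact: sorted_filter ltn_trans _ _ (iota_ltn_sorted _ _).
rewrite mem_filter mem_iota /= andbC; case: (boolP (i \in idx)) => [/(allP idx_lt)->|] //.
by rewrite andbF.
Qed.

(** * Explicit occurrences of the two patterns *)

Lemma contains201P s :
  contains s [:: 2; 0; 1] <->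
  exists i j k, [/\ i < j < k, k < size s & nth 0 s j < nth 0 s k < nth 0 s i].
Proof.
split=> [/containsP[t /(subseq_nthP 0)[idx [idx_s idx_lt ->]]]|].
  case: idx idx_s idx_lt => [|i [|j [|k [|? ?]]]] //=.
  rewrite !andbT => ltijk /and3P[_ _ ltk].
  move=> /andP[_ /forallP so]; exists i, j, k; split=> //.
  have /forallP/(_ (Ordinal (isT : 2 < 3))) /= := so (Ordinal (isT : 1 < 3)).
  have /forallP/(_ (Ordinal (isT : 0 < 3))) /= := so (Ordinal (isT : 2 < 3)).
  by move=> /eqP-> /eqP->.
move=> [i [j [k [ltijk ltk ord]]]]; apply/containsP.
exists [seq nth 0 s l | l <- [:: i; j; k]].
  by apply/(subseq_nthP 0); exists [:: i; j; k]; split=> //=; lia.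
apply/andP; split=> //; apply/'forall_forallP => -[x /= ltx] [y /= lty].
by move: x y ltx lty => [|[|[|x]]] [|[|[|y]]] //= _ _; lia.
Qed.

(** Occurrences are given by values rather than positions, as labels belong to values. Membership of
    [c], [d] and [a] follows from their indices being below that of [b]. *)
Lemma contains3412P s : uniq s ->
  contains s [:: 3; 4; 1; 2] <->
  exists c d a b, [/\ b \in s, a < b < c, c < d
    & [&& index c s < index d s, index d s < index a s & index a s < index b s]].
Proof.
move=> s_uniq; split=> [/containsP[t /(subseq_nthP 0)[idx [idx_s idx_lt ->]]]|].
  case: idx idx_s idx_lt => [|p [|q [|r [|w [|? ?]]]]] //=.
  rewrite !andbT => ltpqrw /and4P[ltp ltq ltr ltw].
  move=> /andP[_ /forallP so].
  exists (nth 0 s p), (nth 0 s q), (nth 0 s r), (nth 0 s w).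
  rewrite mem_nth // !index_uniq //.
  have /forallP/(_ (Ordinal (isT : 3 < 4))) /= := so (Ordinal (isT : 2 < 4)).
  have /forallP/(_ (Ordinal (isT : 0 < 4))) /= := so (Ordinal (isT : 3 < 4)).
  have /forallP/(_ (Ordinal (isT : 1 < 4))) /= := so (Ordinal (isT : 0 < 4)).
  by move=> /eqP-> /eqP-> /eqP->; split=> //; lia.
move=> [c [d [a [b [bs ord ltcd ltidx]]]]]; apply/containsP.
have ltb : index b s < size s by rewrite index_mem.
have memI x : index x s <= index b s -> x \in s by rewrite -index_mem; lia.
exists [:: c; d; a; b].
  apply/(subseq_nthP 0); exists [seq index x s | x <- [:: c; d; a; b]]; split=> /=.
  - by lia.
  - by apply/and5P; split=> //; apply: leq_ltn_trans ltb; lia.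
  - by rewrite !nth_index //; apply: memI; lia.
apply/andP; split=> //; apply/'forall_forallP => -[x /= ltx] [y /= lty].
by move: x y ltx lty => [|[|[|[|x]]]] [|[|[|[|y]]]] //= _ _; lia.
Qed.

(** * Good values and active sites *)

(* In a Fishburn permutation, [v] is good when the site just after [v] is
   active. This only depends on the relative order of [v.-1] and [v], so later
   insertions do not affect it. *)
Definition good (s : seq nat) (v : nat) : bool :=
  (v <= 1) || (index v.-1 s < index v s).

Lemma is_perm_uniq s : is_perm s -> uniq s.
Proof. by move=> /perm_uniq ->; apply: iota_uniq. Qed.

(** At an ascent with bottom [x], the only possible third letter is [x.-1]. It occupies neither
    position of the ascent, so it completes the forbidden pattern unless it lies to the left of [x],
    that is, unless [x] is good. *)
Lemma fishburnE s :
  fishburn s = is_perm s && sorted (fun x y => (x < y) ==> good s x) s.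
Proof.
rewrite /fishburn; case sP: (is_perm s) => //=; have s_uniq := is_perm_uniq sP.
apply/'forall_forallP/(sortedP 0) => [fb i lti|so [j /= ltj] [k /= ltk]].
  apply/implyP => asc_i; rewrite -[good _ _]negbK; apply/negP.
  have vs : nth 0 s i \in s by rewrite mem_nth // ltnW.
  rewrite /good negb_or -ltnNge -leqNgt index_uniq ?(ltnW lti) // => /andP[gt1 le_i].
  have v1s : (nth 0 s i).-1 \in s.
    by move: vs; rewrite !is_perm_mem //; lia.
  have ltk : index (nth 0 s i).-1 s < size s by rewrite index_mem.
  have e : nth 0 s (index (nth 0 s i).-1 s) = (nth 0 s i).-1 :> nat by rewrite nth_index.
  have := fb (Ordinal (ltnW lti)) (Ordinal ltk).
  rewrite /= e asc_i prednK ?eqxx ?andbT //=; last by lia.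
  have ne0 : index (nth 0 s i).-1 s != i by apply/eqP => e'; move: e; rewrite e'; lia.
  have ne1 : index (nth 0 s i).-1 s != i.+1 by apply/eqP => e'; move: e; rewrite e'; lia.
  by lia.
apply/negP => /= /and3P[ltjk /eqP e asc_j].
have /implyP/(_ asc_j) : (nth 0 s j < nth 0 s j.+1) ==> good s (nth 0 s j) by apply: so; lia.
have := mem_nth 0 ltk; rewrite is_perm_mem // => /andP[gt0 _].
rewrite /good e /= index_uniq // -e index_uniq // e ltnS leqNgt gt0 /=; lia.
Qed.

Lemma is_perm_insert i s : is_perm (insert_at i (size s).+1 s) = is_perm s.
Proof.
rewrite /is_perm size_insert_at -[X in iota 1 X]addn1 iotaD add1n.
have /permPl-> : perm_eq (insert_at i (size s).+1 s) ((size s).+1 :: s).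
  by rewrite /insert_at perm_sym -cat1s -{2}(cat_take_drop i s) perm_catCA.
by rewrite perm_sym perm_catC /= perm_cons perm_sym.
Qed.

Lemma index_insert i m s v : i <= size s -> v != m ->
  index v (insert_at i m s) = bump i (index v s).
Proof.
move=> le_i neq; rewrite -{2}(cat_take_drop i s) !index_cat /= eq_sym (negPf neq).
case: ifP => [v_in|_]; last by rewrite size_takel // /bump leq_addr add1n addnS.
rewrite /bump; move: (v_in); rewrite -index_mem size_takel // => lt_i.
by rewrite leqNgt lt_i.
Qed.

Lemma index_insert_max i s : is_perm s -> i <= size s ->
  index (size s).+1 (insert_at i (size s).+1 s) = i.
Proof.
move=> sP le_i; have nNs : (size s).+1 \notin s by rewrite is_perm_mem // ltnn andbF.
rewrite index_cat /= eqxx addn0 ifN ?size_takel //.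
by apply: contra nNs; apply: mem_take.
Qed.

Lemma ltn_bump2 h i j : (bump h i < bump h j) = (i < j).
Proof. by rewrite !ltnNge leq_bump2. Qed.

Lemma good_insert i s v : i <= size s -> v <= size s ->
  good (insert_at i (size s).+1 s) v = good s v.
Proof.
by move=> le_i le_v; rewrite /good !index_insert ?ltn_bump2 //; lia.
Qed.

(** A new maximum is never an ascent bottom, and the letter before it always becomes one; requiring
    [p] there subsumes the condition on the adjacent pair that is split. *)
Lemma sorted_insert (p : pred nat) m s1 s2 :
  {in s1 ++ s2, forall x, x < m} ->
  sorted (fun x y => (x < y) ==> p x) (s1 ++ m :: s2) =
  sorted (fun x y => (x < y) ==> p x) (s1 ++ s2)
    && ((s1 == [::]) || p (last 0 s1)).
Proof.
case/lastP: s1 => [|s1 x] ltm.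
  rewrite andbT /=; case: s2 ltm => //= y s2 ltm.
  by rewrite ltnNge (ltnW (ltm y _)) ?mem_head.
rewrite last_rcons cat_rcons sorted_cat_cons /=.
have ltx : x < m by apply: ltm; rewrite mem_cat mem_rcons mem_head.
rewrite ltx /= -{1}size_eq0 size_rcons /= cat_rcons sorted_cat_cons.
case: s2 ltm => [|y s2] ltm /=; first by rewrite !andbT.
have lty : y < m by apply: ltm; rewrite mem_cat mem_head orbT.
rewrite ltnNge (ltnW lty) /=; case: (p x); rewrite ?implybT ?andbT ?andbF //.
Qed.

Lemma fishburn_insert i s : is_perm s -> i <= size s ->
  fishburn (insert_at i (size s).+1 s) =
  fishburn s && ((i == 0) || good s (nth 0 s i.-1)).
Proof.
move=> sP le_i; rewrite !fishburnE is_perm_insert sP /=.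
have bnd : {in s, forall x, x < (size s).+1}.
  by move=> x; rewrite is_perm_mem // => /andP[_]; rewrite ltnS.
set s' := insert_at _ _ _.
(* Ascent bottoms are at most [size s], so the insertion does not change whether they are good. *)
have -> : sorted (fun x y => (x < y) ==> good s' x) s'
        = sorted (fun x y => (x < y) ==> good s x) s'.
  apply: (@eq_in_sorted _ (mem s')); last exact/allP.
  move=> x y xs ys /=; case: leqP => //= ltxy; apply: good_insert => //.
  have : y <= (size s).+1.
    by rewrite is_perm_mem ?is_perm_insert // size_insert_at in ys; case/andP: ys.
  by lia.
rewrite sorted_insert cat_take_drop //; congr (_ && _).
case: i le_i {s'} => [|i] le_i; first by rewrite take0.
by rewrite (take_nth 0) // last_rcons -size_eq0 size_rcons.
Qed.
Lemma active_siteE s i : fishburn s -> i <= size s ->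
  active_site s i = (i == 0) || good s (nth 0 s i.-1).
Proof.
by move=> sF le_i; rewrite /active_site fishburn_insert ?sF //; case/andP: sF.
Qed.

Lemma active_sites_prefix s i : fishburn s -> i <= size s ->
  count (active_site s) (iota 0 i) = (0 < i) + count (good s) (take i.-1 s).
Proof.
move=> sF; case: i => [|i] lt_i; first by rewrite take0.
rewrite /= active_siteE //= add1n; congr _.+1.
rewrite -(map_nth_iota0 0) ?(ltnW lt_i) // count_map -[1]addn0 iotaDl count_map.
apply: eq_in_count => j; rewrite mem_iota /= add1n => lt_j.
by rewrite active_siteE //; lia.
Qed.

Lemma size_active_sites s : fishburn s ->
  size (active_sites s) = (count (good s) s).+1.
Proof.
move=> sF; rewrite size_filter -addn1 iotaD count_cat active_sites_prefix //=.
rewrite addn0 active_siteE // add0n.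
case/lastP: s sF => [|s x] sF; first by [].
rewrite size_rcons /= nth_rcons ltnn eqxx -cats1 take_size_cat //.
by rewrite count_cat /= addn0 add1n.
Qed.

Lemma index_active_sites s i : fishburn s -> i \in active_sites s ->
  index i (active_sites s) = count (good s) (take i s).
Proof.
move=> sF; rewrite mem_filter mem_iota /= add0n ltnS => /andP[i_act le_i].
rewrite index_filter_iota // active_sites_prefix //.
(* The 1 counted for the leftmost site is traded for the entry just before site [i], which is good
   because [i] is active. *)
move: i_act; rewrite active_siteE //; case: i le_i => [|i] lt_i gi; first by rewrite !take0.
by rewrite (take_nth 0) // -cats1 count_cat /= (gi : good _ _) addn0 addnC.
Qed.

(** * Building Fishburn permutations by insertion; injectivity of [g] *)

(** Deleting the maximum keeps the permutation Fishburn, by [fishburn_insert] read from left to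
    right. *)
Lemma fishburn_caseP s : fishburn s ->
  s = [::] \/ exists s' i, [/\ fishburn s', i \in active_sites s'
                             & s = insert_at i (size s').+1 s'].
Proof.
case: (posnP (size s)) => [/size0nil->|s_gt0 sF]; [by left | right].
have sP : is_perm s by case/andP: sF.
have ns : size s \in s by rewrite is_perm_mem // s_gt0 leqnn.
set i := index (size s) s; set s' := take i s ++ drop i.+1 s.
have lt_i : i < size s by rewrite index_mem.
have sz' : (size s').+1 = size s.
  by rewrite size_cat size_takel ?(ltnW lt_i) // size_drop; lia.
have le_i : i <= size s' by lia.
have sE : s = insert_at i (size s').+1 s'.
  rewrite /insert_at sz' take_size_cat ?size_takel ?(ltnW lt_i) //.
  rewrite drop_size_cat ?size_takel ?(ltnW lt_i) //.
  by rewrite -[in X in _ ++ X :: _](nth_index 0 ns) -drop_nth // cat_take_drop.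
have sP' : is_perm s' by rewrite -(is_perm_insert i) -sE.
have sF' : fishburn s' by move: sF; rewrite sE fishburn_insert // => /andP[].
exists s', i; split=> //.
by rewrite mem_filter mem_iota /= add0n ltnS le_i andbT /active_site -sE.
Qed.

Lemma fishburn_ind (P : seq nat -> Prop) :
  P [::] ->
  (forall s i, fishburn s -> i \in active_sites s -> P s ->
     P (insert_at i (size s).+1 s)) ->
  forall s, fishburn s -> P s.
Proof.
move=> P0 Pins s; have [n] := ubnP (size s); elim: n s => // n IHn s lt_s sF.
case: (fishburn_caseP sF) => [->//|[s' [i [sF' i_act sE]]]].
rewrite sE; apply: Pins => //; apply: IHn => //.
by move: lt_s; rewrite sE size_insert_at.
Qed.

Lemma g_insert s i : fishburn s -> i \in active_sites s ->
  g (insert_at i (size s).+1 s) = rcons (g s) (index i (active_sites s)).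
Proof.
move=> sF i_act; rewrite -{1}(nth_index 0 i_act) g_insert_active ?index_mem //.
by case/andP: sF.
Qed.

Lemma size_g s : size (g s) = size s.
Proof. by rewrite size_map size_iota. Qed.

Lemma g_inj s t : fishburn s -> fishburn t -> g s = g t -> s = t.
Proof.
move=> sF; elim/fishburn_ind: sF t => {s} [|s i sF i_act IHs] t tF.
  by move/(congr1 size)/esym; rewrite !size_g => /size0nil.
case: (fishburn_caseP tF) => [->|[t' [j [tF' j_act ->]]]].
  by move/(congr1 size); rewrite !size_g size_insert_at.
rewrite !g_insert // => /rcons_inj[/(IHs _ tF') st e]; subst t'.
by rewrite -(nth_index 0 i_act) e nth_index.
Qed.

(** * Labels read off from the final permutation *)

Definition before (s : seq nat) (m v : nat) : bool :=
  [&& good s v, v < m & index v s < index m s].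

Definition label (s : seq nat) (m : nat) : nat := count (before s m) s.

(** Later insertions preserve both goodness and relative order, so a label can be computed in the
    whole permutation instead of at its stage. Position [i] belongs to the value [i.+1]. *)
Lemma nth_g s i : fishburn s -> i < size s -> nth 0 (g s) i = label s i.+1.
Proof.
move=> sF; elim/fishburn_ind: sF i => {s} [//|s i sF i_act IHs] k.
have sP : is_perm s by case/andP: sF.
have le_i : i <= size s by move: i_act; rewrite mem_filter mem_iota => /andP[].
rewrite size_insert_at ltnS g_insert // nth_rcons size_g => le_k.
set s' := insert_at _ _ _.
have bndP v : v \in s -> v <= size s.
  by rewrite is_perm_mem // => /andP[].
have neqP v : v <= size s -> v != (size s).+1 by lia.
have labE m : label s' m = count (before s' m) s + before s' m (size s).+1.
  rewrite /label {2}/s' count_cat /= addnCA -count_cat cat_take_drop addnC.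
  by congr (_ + _).
rewrite labE; case: ltnP => [lt_k|ge_k].
  rewrite IHs // [before s' _ (size s).+1]/before ltnNge (leqW lt_k) andbF addn0.
  apply: eq_in_count => v vs.
  have le_v := bndP v vs.
  by rewrite /before /s' good_insert ?index_insert ?ltn_bump2 ?neqP //.
have -> : k = size s by apply/eqP; rewrite eqn_leq le_k.
rewrite eqxx index_active_sites // [before s' _ (size s).+1]/before ltnn andbF addn0.
(* For the new maximum, only the entries of [take i s] count; those of [drop i s] lie on its
   right. *)
have := is_perm_uniq sP; rewrite -{1}(cat_take_drop i s) cat_uniq => /and3P[_ no_s _].
rewrite -[X in _ = count _ X](cat_take_drop i s) count_cat.
rewrite [X in _ = _ + X](_ : _ = 0) ?addn0.
  apply: eq_in_count => v v_in; have le_v := bndP v (mem_take v_in).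
  rewrite /before /s' good_insert // index_insert_max // index_insert ?neqP //.
  by move: v_in; rewrite in_take_leq // ltnS le_v /bump => lt_i; rewrite (leqNgt i) lt_i /= add0n lt_i andbT.
apply/eqP; rewrite -leqn0 leqNgt -has_count; apply/hasPn => v v_in.
have le_v := bndP v (mem_drop v_in).
have := hasPn no_s v v_in; rewrite in_take_leq // -leqNgt => le_iv.
rewrite /before /s' index_insert_max // index_insert ?neqP //.
by apply/negP => /and3P[_ _]; rewrite /bump le_iv; lia.
Qed.

(* The last entry smaller than [m] on the left of [m] is followed by a larger
   entry, so it is good by the Fishburn condition. *)
Lemma good_between s m x : fishburn s -> m \in s -> x < m ->
  index x s < index m s ->
  exists u, [/\ u \in s, good s u, u < m & index x s <= index u s < index m s].
Proof.
move=> sF ms lt_xm lt_idx; have sP : is_perm s by case/andP: sF.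
have lt_m : index m s < size s by rewrite index_mem.
have xs : x \in s by rewrite -index_mem; apply: ltn_trans lt_m.
pose p q := (q < index m s) && (nth 0 s q < m).
have p_x : p (index x s) by rewrite /p lt_idx nth_index.
have p_le q : p q -> q <= index m s by case/andP => /ltnW.
case: (ex_maxnP (ex_intro (fun q => p q) _ p_x) p_le) => q /andP[lt_q nth_q] q_max.
have lt_qs := ltn_trans lt_q lt_m.
exists (nth 0 s q); rewrite mem_nth // index_uniq ?is_perm_uniq // lt_q q_max //.
split=> //; move: sF; rewrite fishburnE => /andP[_ /(sortedP 0)/(_ q)].
move=> /(_ (leq_ltn_trans lt_q lt_m))/implyP; apply; apply: leq_trans nth_q _.
have [e|ne] := eqVneq q.+1 (index m s); first by rewrite e nth_index.
rewrite leqNgt; apply/negP => nth_q1.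
have /q_max : p q.+1 by rewrite /p nth_q1 andbT ltn_neqAle ne.
by rewrite ltnn.
Qed.

(** If [m.+1] lies to the right of [m], it counts everything that [m] counts, plus a good value
    supplied by [good_between] from [m] onwards. Otherwise [m] counts everything that [m.+1]
    counts. *)
Lemma label_ltn s m : fishburn s -> 0 < m < size s ->
  (label s m < label s m.+1) = good s m.+1.
Proof.
move=> sF /andP[m_gt0 lt_m]; have sP : is_perm s by case/andP: sF.
have ms : m \in s by rewrite is_perm_mem // m_gt0 ltnW.
have m1s : m.+1 \in s by rewrite is_perm_mem.
have gE : good s m.+1 = (index m s < index m.+1 s) by rewrite /good ltnS leqn0 gtn_eqF.
apply/idP/idP => [|m1_good]; last first.
  have lt_idx : index m s < index m.+1 s by rewrite -gE.
  have [u [us u_good lt_u /andP[le_u lt_ui]]] := good_between sF m1s (ltnSn m) lt_idx.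
  apply: (ltn_in_count (u := u)) => // [v vs||].
  - by rewrite /before => /and3P[-> lt_vm lt_vi]; rewrite ltnW //= (ltn_trans lt_vi).
  - by rewrite /before u_good lt_u.
  - by apply/negP => /and3P[_ _]; rewrite ltnNge le_u.
apply: contraLR; rewrite gE -leqNgt => le_idx; rewrite -leqNgt.
apply: sub_in_count => v vs /and3P[v_good]; rewrite ltnS leq_eqVlt => lt_v lt_vi.
have lt_vi' : index v s < index m s by apply: leq_trans lt_vi _.
rewrite /before v_good lt_vi' andbT /=.
by case/orP: lt_v => // /eqP e; rewrite e ltnn in lt_vi'.
Qed.

(** * Ascents of [g s] and surjectivity onto ascent sequences *)

(** By [label_ltn] the good values above 1 correspond to the ascents of [g s]; the value 1 is always
    good and accounts for the successor. *)
Lemma count_good s : fishburn s ->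
  count (good s) s = if s is [::] then 0 else (asc (g s)).+1.
Proof.
move=> sF; have sP : is_perm s by case/andP: sF.
rewrite (permP sP); case: s sF sP => // x s0; set s := x :: s0 => sF sP.
have gE i : i < size s -> nth 0 (g s) i = label s i.+1 by apply: nth_g.
rewrite /asc size_g; move: (g s) gE => gs gE.
rewrite /= add1n; congr _.+1; rewrite -[2]/(2 + 0) iotaDl count_map.
apply: eq_in_count => i; rewrite mem_iota /= add0n => lt_i.
by rewrite !gE ?label_ltn //= ltnW.
Qed.

(** The bound is written in the form of [count_good]: for [a = g s] it says exactly that [x] is the
    number of an active site of [s]. *)
Lemma ascent_seq_rcons a x : ascent_seq (rcons a x) =
  ascent_seq a && (x <= if a is [::] then 0 else (asc a).+1).
Proof.
case/lastP: a => [|a y].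
  apply/andP/andP => [[x0 _]|[_ x0]]; split=> //.
  - by apply/andP; split=> //; apply/forallP => -[].
  - by rewrite /= leqn0.
  - by rewrite /= -leqn0.
  - by apply/forallP => -[[]].
set b := rcons a y.
have -> : (if b is [::] then 0 else (asc b).+1) = (asc b).+1 by rewrite /b; case: (a).
have nthE j : j < size b -> nth 0 (rcons b x) j = nth 0 b j.
  by move=> lt_j; rewrite nth_rcons lt_j.
have takeE j : j <= size b -> take j (rcons b x) = take j b.
  by move=> le_j; rewrite -cats1 takel_cat.
have b_gt0 : 0 < size b by rewrite size_rcons.
have last_x : nth 0 (rcons b x) (size b) = x by rewrite nth_rcons ltnn eqxx.
rewrite /ascent_seq nthE // -andbA; congr (_ && _).
apply/forallP/andP => [bP|[/forallP bP le_x] [j /=]].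
  split; last first.
    have lt_b : size b < size (rcons b x) by rewrite size_rcons.
    by have := bP (Ordinal lt_b); rewrite /= b_gt0 last_x takeE // take_size.
  apply/forallP => -[j /= lt_j].
  have lt_jx : j < size (rcons b x) by rewrite size_rcons ltnW.
  by have := bP (Ordinal lt_jx); rewrite /= nthE // takeE // ltnW.
rewrite size_rcons ltnS leq_eqVlt => /predU1P[->|lt_j].
  by rewrite b_gt0 last_x takeE // take_size.
by have := bP (Ordinal lt_j); rewrite /= nthE // takeE // ltnW.
Qed.

Lemma g_ascent_seq s : fishburn s -> ascent_seq (g s).
Proof.
elim/fishburn_ind => {s} [|s i sF i_act IHs]; first by apply/andP; split=> //; apply/forallP => -[].
rewrite g_insert // ascent_seq_rcons IHs /=.
have := i_act; rewrite -index_mem size_active_sites // count_good //.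
by case: s {IHs i_act} sF => [|x s] sF; rewrite ltnS // -size_eq0.
Qed.

Lemma g_surj a : ascent_seq a -> exists2 s, fishburn s & g s = a.
Proof.
elim/last_ind: a => [_|a x IHa]; first by exists [::] => //; apply/andP; split=> //; apply/forallP => -[].
rewrite ascent_seq_rcons => /andP[/IHa[s sF <-] le_x].
have lt_x : x < size (active_sites s).
  rewrite size_active_sites // count_good // ltnS.
  by case: s sF le_x.
have i_act := mem_nth 0 lt_x.
exists (insert_at (nth 0 (active_sites s) x) (size s).+1 s).
  by move: i_act; rewrite mem_filter => /andP[].
by rewrite g_insert // index_uniq // filter_uniq // iota_uniq.
Qed.

(** * The patterns 201 and 3412 under [g] *)

Lemma g_contains201 s : fishburn s ->
  contains (g s) [:: 2; 0; 1] -> contains s [:: 3; 4; 1; 2].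
Proof.
move=> sF /contains201P[i [j [k [/andP[lt_ij lt_jk] + +]]]]; rewrite size_g => lt_k.
have sP : is_perm s by case/andP: sF.
rewrite !nth_g //; [|lia..] => /andP[].
have i_s : i.+1 \in s by rewrite is_perm_mem //; lia.
have j_s : j.+1 \in s by rewrite is_perm_mem //; lia.
have k_s : k.+1 \in s by rewrite is_perm_mem //; lia.
(* From here on [i], [j], [k] denote values instead of positions in [g s]. *)
move: i.+1 j.+1 k.+1 (lt_ij : i.+1 < j.+1) (lt_jk : j.+1 < k.+1) i_s j_s k_s.
move=> {lt_k lt_ij lt_jk} {}i {}j {}k lt_ij lt_jk i_s j_s k_s lt_lab_jk lt_lab_ki.
have idx_inj := @index_inj _ 0 s.
(* Otherwise every value counted for [i] would also be counted for [k]. *)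
have lt_idx_ki : index k s < index i s.
  rewrite ltnNge; apply/negP => le_idx; move: lt_lab_ki; rewrite ltnNge => /negP; apply.
  apply: sub_in_count => v vs /and3P[v_good lt_v lt_vi].
  by rewrite /before v_good; lia.
(* If [j] is not to the left of [k], a value counted for [k] but not for [j] is still to the left of
   [j], so it must be at least [j]. *)
have [w [ws lt_wk lt_widx]] : exists w, [/\ w \in s, j <= w < k & index w s < index k s].
  have [lt_jk_idx|le_kj_idx] := ltnP (index j s) (index k s); first by exists j; rewrite leqnn.
  have [w ws /andP[/and3P[w_good lt_wk lt_widx]]] := ltn_count_ex lt_lab_jk.
  by rewrite /before w_good /= => lt_jw; exists w; split=> //; lia.
have [v vs /andP[/and3P[v_good lt_vi lt_vidx]]] := ltn_count_ex lt_lab_ki.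
rewrite /before v_good /= => nlt_vk.
apply/contains3412P; first exact: is_perm_uniq.
have ne_kv : index k s != index v s by apply/eqP => /(idx_inj _ _ k_s vs) e; lia.
by exists w, k, v, i; split=> //; lia.
Qed.

(* Taking [d] minimal leaves no good value between [b] and [d] on the left of
   [d]; the labels of [b], [c], [d] then form a 201. *)
Lemma contains3412_g s : fishburn s ->
  contains s [:: 3; 4; 1; 2] -> contains (g s) [:: 2; 0; 1].
Proof.
move=> sF; have sP : is_perm s by case/andP: sF.
case/(contains3412P (is_perm_uniq sP)) => c [d] [a] [b] [bs].
elim/ltn_ind: d c => d IHd c ord lt_cd idx_ord.
have inS x : index x s <= index b s -> x \in s.
  by rewrite -!index_mem => le_x; apply: leq_ltn_trans le_x _; rewrite index_mem.
(* For such a good [e], the value [e.-1] lies to its left and differs from [b], which is to the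
   right of [d]; so [e.-1], [e], [a], [b] is an occurrence with a smaller second letter. *)
have [/hasP[e es /and4P[e_good lt_be lt_ed lt_eidx]]|/hasPn no_good] :=
  boolP (has (fun e => [&& good s e, b < e, e < d & index e s < index d s]) s).
  move: e_good; rewrite /good => /orP[|e_good]; first by lia.
  have ne_b : e.-1 != b by apply/eqP => e1b; move: e_good; rewrite e1b; lia.
  by apply: (IHd e lt_ed e.-1); lia.
have cs : c \in s by apply: inS; lia.
have ds : d \in s by apply: inS; lia.
have [|u [us u_good lt_ud idx_u]] := good_between (x := c) sF ds lt_cd; first by lia.
have [||w [ws w_good lt_wb idx_w]] := good_between (x := a) sF bs; [lia..|].
have le_ub : u <= b by have := no_good u us; rewrite u_good /=; lia.
have ne_ub : u != b by apply/eqP => ub; rewrite ub in idx_u; lia.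
(* The good value [u], between [c] and [d] in position, is counted for [d] only; below, [w], between
   [a] and [b], is counted for [b] but not for [d]. *)
have lab_cd : label s c < label s d.
  apply: (ltn_in_count (u := u)) => // [v vs /and3P[v_good lt_vc lt_vidx]||].
  - by rewrite /before v_good; lia.
  - by rewrite /before u_good; lia.
  - by apply/negP => /and3P[_ _]; lia.
have lab_db : label s d < label s b.
  apply: (ltn_in_count (u := w)) => // [v vs /and3P[v_good lt_vd lt_vidx]||].
  - have ne_vb : v != b by apply/eqP => vb; rewrite vb in lt_vidx; lia.
    by have := no_good v vs; rewrite /before v_good; lia.
  - by rewrite /before w_good; lia.
  - by apply/negP => /and3P[_ _]; lia.
have [b_gt0 c_gt0 d_gt0] : [/\ 0 < b, 0 < c & 0 < d] by split; lia.
have le_d : d <= size s by move: ds; rewrite is_perm_mem // => /andP[].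
apply/contains201P; exists b.-1, c.-1, d.-1; rewrite size_g.
by rewrite !nth_g ?prednK //; [split=> //; lia | lia..].
Qed.

(** * Transfer to cardinalities *)

Lemma card_F_eq_A n sigma beta :
  (forall s, fishburn s -> avoids s sigma = avoids (g s) beta) ->
  #|F n sigma| = #|A n beta|.
Proof.
(* The default [t] and the truncation by [inord] never take effect on Fishburn input: [g] preserves
   the size, and [ascent_seq_bound] keeps the letters at most [n]. *)
move=> gE; pose G (t : n.-tuple 'I_n.+1) : n.-tuple 'I_n.+1 :=
  insubd t [seq inord x | x <- g [seq val x | x <- t]].
have GE (t : n.-tuple 'I_n.+1) : fishburn [seq val x | x <- t] ->
    [seq val x | x <- G t] = g [seq val x | x <- t].
  move=> tF; have sz : size (g [seq val x | x <- t]) = n.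
    by rewrite size_g size_map size_tuple.
  rewrite val_insubd size_map sz eqxx -map_comp -[RHS]map_id.
  apply/eq_in_map => x /(nthP 0)[i lt_i <-] /=; rewrite inordK // ltnS.
  apply: leq_trans (ascent_seq_bound (g_ascent_seq tF) lt_i) _.
  by rewrite -sz ltnW.
rewrite -(@card_in_imset _ _ G) => [|t u /[!inE] /andP[tF _] /andP[uF _] e].
  apply: eq_card => a; apply/imsetP/idP => [[t /[!inE] /andP[tF t_av] ->]|].
    by rewrite GE // g_ascent_seq // -gE.
  rewrite inE => /andP[aA a_av]; have [s sF sa] := g_surj aA.
  have sz : size s = n by rewrite -size_g sa size_map size_tuple.
  have [t t_in tE] : exists2 t, t \in F n sigma & [seq val x | x <- t] = s.
    by apply/F_spec; rewrite gE // sa.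
  exists t => //; apply: val_inj; apply: (inj_map val_inj).
  by rewrite GE tE // sa.
apply: val_inj; apply: (inj_map val_inj); apply: g_inj => //.
by rewrite -!GE // e.
Qed.

Theorem proposition3p4 :
  (forall pi alpha : seq nat, fishburn pi -> g pi = alpha ->
     avoids pi [:: 3; 4; 1; 2] <-> avoids alpha [:: 2; 0; 1]) /\
  (forall n : nat, #|F n [:: 3; 4; 1; 2]| = #|A n [:: 2; 0; 1]|).
Proof.
have gE s : fishburn s -> avoids s [:: 3; 4; 1; 2] = avoids (g s) [:: 2; 0; 1].
  move=> sF; congr negb; apply/idP/idP; first exact: contains3412_g.
  exact: g_contains201.
split=> [s _ sF <-|n]; first by rewrite gE.
exact: card_F_eq_A.
Qed.
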